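(* Let $m>3$. Let $V=\mathbb{F}_4^m$ carry a nondegenerate Hermitian form $h$ (with respect to the involution $a\mapsto a^2$). Let $\mathrm{NU}_m(2)$ be the graph whose vertices are the $1$-dimensional subspaces $\langle x\rangle$ of $V$ with $h(x,x)\neq 0$, two distinct vertices being adjacent if the $2$-dimensional subspace they span contains exactly one $1$-dimensional subspace $\langle z\rangle$ with $h(z,z)=0$ (i.e. the line they span is tangent to the Hermitian variety). Then $\mathrm{NU}_m(2)$ is separating.
   Context: A graph $\Gamma$ is separating if $\omega(\Gamma)\alpha(\Gamma)<|V(\Gamma)|$, where $\omega$ and $\alpha$ are the maximum clique and coclique sizes. *)

(* Defs.v *)
From HB Require Import structures.
From mathcomp Require Import all_boot all_order all_algebra.
From mathcomp Require Import sesquilinear.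

Set Implicit Arguments.
Unset Strict Implicit.
Unset Printing Implicit Defensive.

Import GRing.Theory.
Local Open Scope ring_scope.

Record sgraph := SGraph {
  vertex :> finType;
  adj : rel vertex;
  adj_sym : symmetric adj;
  adj_irr : irreflexive adj }.

Definition clique (G : sgraph) (A : {set G}) : bool :=
  [forall x in A, forall y in A, (x != y) ==> adj x y].

Definition coclique (G : sgraph) (A : {set G}) : bool :=
  [forall x in A, forall y in A, (x != y) ==> ~~ adj x y].

Definition omega (G : sgraph) : nat := (\max_(A : {set G} | clique A) #|A|)%N.

Definition alpha (G : sgraph) : nat := (\max_(A : {set G} | coclique A) #|A|)%N.

Definition separating (G : sgraph) : bool := (omega G * alpha G < #|G|)%N.

Section VspaceFinite.
Import VectorInternalTheory.
Variables (F : finFieldType) (vT : vectType F).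

HB.instance Definition _ := [Countable of {vspace vT} by <:].
HB.instance Definition _ := [Finite of {vspace vT} by <:].

End VspaceFinite.

(* Both predicates do not depend on the choice of the generator, since
   h (a *: x) (a *: x) = a * theta a * h x x. *)
Definition nonisotropic (F : finFieldType) (m : nat) (theta : {rmorphism F -> F})
    (h : {hermitian_sym 'rV[F]_m for theta}) (P : {vspace 'rV[F]_m}) : bool :=
  [exists x : 'rV[F]_m, [&& x != 0, P == <[x]>%VS & h x x != 0]].

Definition isotropic (F : finFieldType) (m : nat) (theta : {rmorphism F -> F})
    (h : {hermitian_sym 'rV[F]_m for theta}) (P : {vspace 'rV[F]_m}) : bool :=
  [exists z : 'rV[F]_m, [&& z != 0, P == <[z]>%VS & h z z == 0]].

Definition tangent (F : finFieldType) (m : nat) (theta : {rmorphism F -> F})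
    (h : {hermitian_sym 'rV[F]_m for theta}) (L : {vspace 'rV[F]_m}) : bool :=
  #|[set P : {vspace 'rV[F]_m} | isotropic h P && (P <= L)%VS]| == 1%N.

Definition NU_adj (F : finFieldType) (m : nat) (theta : {rmorphism F -> F})
    (h : {hermitian_sym 'rV[F]_m for theta}) :
    rel {P : {vspace 'rV[F]_m} | nonisotropic h P} :=
  fun P Q => (P != Q) && tangent h (val P + val Q)%VS.

Lemma NU_adj_sym (F : finFieldType) (m : nat) (theta : {rmorphism F -> F})
    (h : {hermitian_sym 'rV[F]_m for theta}) : symmetric (NU_adj (h := h)).
Proof. by move=> P Q; rewrite /NU_adj eq_sym addvC. Qed.

Lemma NU_adj_irr (F : finFieldType) (m : nat) (theta : {rmorphism F -> F})
    (h : {hermitian_sym 'rV[F]_m for theta}) : irreflexive (NU_adj (h := h)).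
Proof. by move=> P; rewrite /NU_adj eqxx. Qed.

(* When #|F| = q ^ 2 and theta is a |-> a ^+ q this is the graph NU_m(q). *)
Definition NU (F : finFieldType) (m : nat) (theta : {rmorphism F -> F})
    (h : {hermitian_sym 'rV[F]_m for theta}) : sgraph :=
  SGraph (@NU_adj_sym F m theta h) (@NU_adj_irr F m theta h).

(* Main.v *)
(** Every nonisotropic point has a generator x with h x x = 1, and two distinct
    such points are adjacent iff h x y != 0.  So cocliques are orthogonal sets,
    of size at most m, and a clique C corresponds to a set D of 3|C| unit
    vectors, no two of them orthogonal.

    Let N_k be the number of unit vectors of a nondegenerate k-space U.  Summing
    the size of D inside the hyperplane y^perp over the unit vectors y of U
    outside D, and bounding each term by induction, gives k|D| <= N_k.  A strict
    inequality in dimension k yields a strict one in dimension k + 1, so the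
    crux is k = 4, where |D| = 30 (an ovoid of the generalized quadrangle W(3))
    must be excluded.  In that case a tangent line with a point in D has exactly
    two points in D.  Take u outside D, and w outside D in u^perp: the three
    points of D in u^perp that are not orthogonal to w would be paired off by
    the tangent lines through w. *)

Require Import Defs.
From HB Require Import structures.
From mathcomp Require Import all_boot all_order all_algebra.
From mathcomp Require Import sesquilinear finfield zify ring.

Set Implicit Arguments.
Unset Strict Implicit.
Unset Printing Implicit Defensive.

Import GRing.Theory.
Local Open Scope ring_scope.

Lemma card_set_sum (T : finType) (A : {set T}) (P : pred T) :
  #|[set x in A | P x]| = (\sum_(x in A) P x)%N.
Proof.
rewrite -sum1dep_card big_mkcondr; apply: eq_bigr => x _.
by case: (P x).
Qed.

(** * Arithmetic in the field of four elements *)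

Section FieldOfFourElements.
Variables (F : finFieldType) (F4 : #|F| = 4%N).
Implicit Types a b : F.

Lemma pchar2_F4 : 2%N \in [pchar F].
Proof. by apply: (@card_finPcharP F 2 2). Qed.

Lemma expr4_F4 a : a ^+ 4 = a.
Proof. by rewrite -[in LHS]F4 expf_card. Qed.

Lemma expr3_F4 a : a != 0 -> a ^+ 3 = 1.
Proof. by move=> a0; apply: (mulfI a0); rewrite -exprS expr4_F4 mulr1. Qed.

Lemma sqrrD_F4 a b : (a + b) ^+ 2 = a ^+ 2 + b ^+ 2.
Proof. by rewrite sqrrD mulr2n (addrr_pchar2 pchar2_F4) addr0. Qed.

Lemma idem_F4 a : a ^+ 2 = a -> a = 0 \/ a = 1.
Proof.
move=> /eqP; rewrite expr2 -subr_eq0 -{3}[a]mulr1 -mulrBr mulf_eq0 subr_eq0.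
by case/orP=> /eqP; [left | right].
Qed.

(** Any a outside {0, 1} works: a + a^2 is fixed by squaring, hence 0 or 1, and it is 0 only for a =
    0 or a = 1. *)
Lemma trace1_F4 : exists a, a + a ^+ 2 = 1.
Proof.
have: ~~ ([set: F] \subset [set 0; 1]).
  by apply/negP => /subset_leq_card; rewrite cardsT F4 cards2; case: (_ != _).
case/subsetPn => a _; rewrite !inE negb_or => /andP[a0 a1]; exists a.
have : (a + a ^+ 2) ^+ 2 = a + a ^+ 2.
  by rewrite sqrrD_F4 -exprM expr4_F4 addrC.
case/idem_F4 => // /eqP; rewrite expr2 -{1}[a]mulr1 -mulrDr mulf_eq0 (negPf a0) /=.
by rewrite addr_eq0 (oppr_pchar2 pchar2_F4) eq_sym (negPf a1).
Qed.

End FieldOfFourElements.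

(** * Hermitian spaces over this field, and splitting off a unit vector *)

Section HermitianSpace.
Variables (F : finFieldType) (m : nat).
Local Notation V := 'rV[F]_m.
Variable h : V -> V -> F.
Implicit Types (a b : F) (u v w x y r : V) (U D : {set V}) (k : nat).

(** A subspace is a plain set of vectors whose dimension k is read off from its size, so that e^perp
    is a filtered set and induction on k is direct. *)
Definition subspace_nondeg k U :=
  [/\ forall a u v, u \in U -> v \in U -> a *: u + v \in U,
      #|U| = (4 ^ k)%N &
      forall u, u \in U -> (forall v, v \in U -> h u v = 0) -> u = 0].

Definition units U := [set u in U | h u u == 1].
Definition perp x U := [set u in U | h u x == 0].
Definition nonorth D := forall x y, x \in D -> y \in D -> h x y != 0.

(** First values, from k = 0 on: 0, 3, 6, 36, 120. The recursion is that of [card_units_rec]. *)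
Fixpoint num_units k : nat :=
  if k is k'.+1 then (3 * 4 ^ k' - 2 * num_units k')%N else 0%N.

Hypothesis F4 : #|F| = 4%N.
Hypothesis hDl : forall u v w, h (u + v) w = h u w + h v w.
Hypothesis hZl : forall a u v, h (a *: u) v = a * h u v.
Hypothesis hC : forall u v, h u v = h v u ^+ 2.

Let addFF (a : F) : a + a = 0 := addrr_pchar2 (pchar2_F4 F4) a.

Lemma vec_pchar2 u : u + u = 0.
Proof. by rewrite -[u]scale1r -scalerDl addFF scale0r. Qed.

Lemma hDr u v w : h u (v + w) = h u v + h u w.
Proof. by rewrite hC hDl (sqrrD_F4 F4) -!hC. Qed.

Lemma hZr a u v : h u (a *: v) = a ^+ 2 * h u v.
Proof. by rewrite hC hZl exprMn -hC. Qed.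

Lemma h0l u : h 0 u = 0.
Proof. by rewrite -(scale0r 0) hZl mul0r. Qed.

Lemma h_eq0C u v : (h u v == 0) = (h v u == 0).
Proof. by rewrite hC expf_eq0. Qed.

Lemma hZZ a u : h (a *: u) (a *: u) = a ^+ 3 * h u u.
Proof. by rewrite hZl hZr mulrA -exprS. Qed.

Lemma hDD u v : h (u + v) (u + v) = h u u + h v v + (h u v + h u v ^+ 2).
Proof. by rewrite hDl !hDr (hC v u) [h u v ^+ 2 + _]addrC addrACA. Qed.

Lemma h_diag u : h u u = 0 \/ h u u = 1.
Proof. by apply: idem_F4; rewrite -hC. Qed.

Lemma unitsP U u : reflect (u \in U /\ h u u = 1) (u \in units U).
Proof. by rewrite inE; apply: (iffP andP) => -[? /eqP]. Qed.

Lemma perpP x U u : reflect (u \in U /\ h u x = 0) (u \in perp x U).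
Proof. by rewrite inE; apply: (iffP andP) => -[? /eqP]. Qed.

Section Subspace.
Variables (k : nat) (U : {set V}) (gU : subspace_nondeg k U).

Lemma subsp_lin a u v : u \in U -> v \in U -> a *: u + v \in U.
Proof. by case: gU => + _ _; apply. Qed.

Lemma subsp_card : #|U| = (4 ^ k)%N. Proof. by case: gU. Qed.

Lemma subsp_0 : 0 \in U.
Proof.
have /card_gt0P[u uU] : (0 < #|U|)%N by rewrite subsp_card expn_gt0.
by rewrite -(addNr u) -scaleN1r subsp_lin.
Qed.

Lemma subsp_Z a u : u \in U -> a *: u \in U.
Proof. by move=> uU; rewrite -[_ *: _]addr0 subsp_lin ?subsp_0. Qed.

Lemma subsp_D u v : u \in U -> v \in U -> u + v \in U.
Proof. by move=> uU vU; rewrite -[u]scale1r subsp_lin. Qed.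

(** Take v in U with h r v != 0. If neither r nor v is a unit vector, both are isotropic and (t / h
    r v) r + v has norm t + t^2, which is 1 for a suitable t. *)
Lemma unit_not_perp r : r \in U -> r != 0 -> exists2 e, e \in units U & h r e != 0.
Proof.
move=> rU r0.
have [v vU hrv] : exists2 v, v \in U & h r v != 0.
  apply/exists_inP; apply: contraNT r0 => /exists_inPn hr0; apply/eqP.
  by case: gU => _ _; apply=> // v /hr0; rewrite negbK => /eqP.
case: (h_diag r) => [hrr|hrr]; last first.
  by exists r; [apply/unitsP | rewrite hrr oner_neq0].
case: (h_diag v) => [hvv|hvv]; last by exists v => //; apply/unitsP.
have [t ht] := trace1_F4 F4.
exists ((t / h r v) *: r + v).
  apply/unitsP; split; first exact: subsp_lin.
  by rewrite hDD hZZ hrr hvv hZl divfK // mulr0 !add0r.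
by rewrite hDr hZr hrr mulr0 add0r.
Qed.

(** Orthogonal projection along e; characteristic 2 absorbs the sign. *)
Lemma subsp_split e u : e \in units U -> u \in U ->
  u + h u e *: e \in perp e U.
Proof.
move=> /unitsP[eU ee] uU; apply/perpP; split.
  by rewrite addrC subsp_lin.
by rewrite hDl hZl ee mulr1 addFF.
Qed.

Lemma split_inj e : e \in units U ->
  {in setX setT (perp e U) &, injective (fun p : F * V => p.1 *: e + p.2)}.
Proof.
move=> /unitsP[eU ee] [a u] [b v] /setXP[_ /perpP[_ /= ue]] /setXP[_ /perpP[_ /= ve]] /= E.
have ab : a = b.
  by have := congr1 (h^~ e) E; rewrite !hDl !hZl ee ue ve !mulr1 !addr0.
by move: E; rewrite ab => /addrI ->.
Qed.

Lemma split_image e : e \in units U ->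
  U = [set p.1 *: e + p.2 | p in setX [set: F] (perp e U)].
Proof.
move=> eU; have /unitsP[eU' _] := eU.
apply/setP=> u; apply/idP/imsetP => [uU|[[a v] /setXP[_ /perpP[vU _]] ->]].
  exists (h u e, u + h u e *: e); first by rewrite in_setX inE subsp_split.
  by rewrite /= addrCA vec_pchar2 addr0.
exact: subsp_lin.
Qed.

End Subspace.

(** * Counting unit vectors; orthogonal sets of them *)

Lemma unit_exists k U : subspace_nondeg k.+1 U -> exists e, e \in units U.
Proof.
move=> gU; have : ~~ (U \subset [set 0]).
  apply/negP=> /subset_leq_card; rewrite (subsp_card gU) cards1 expnS.
  by have := expn_gt0 4 k; lia.
case/subsetPn => r rU; rewrite inE => /(unit_not_perp gU rU)[e eU _].
by exists e.
Qed.

Lemma nondeg_perp k U e : subspace_nondeg k.+1 U -> e \in units U ->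
  subspace_nondeg k (perp e U).
Proof.
move=> gU eU; split.
- move=> a u v /perpP[uU ue] /perpP[vU ve]; apply/perpP.
  by rewrite (subsp_lin gU) // hDl hZl ue ve mulr0 addr0.
- have := subsp_card gU; rewrite {1}(split_image gU eU) card_in_imset; last exact: split_inj eU.
  by rewrite cardsX cardsT F4 expnS => /eqP; rewrite eqn_pmul2l // => /eqP.
- move=> u /perpP[uU ue] hu; have [_ _ nU] := gU; apply: nU => // v vU.
  have := hu _ (subsp_split gU eU vU).
  by rewrite hDr hZr ue mulr0 addr0.
Qed.

Lemma card_units_rec k U e : subspace_nondeg k.+1 U -> e \in units U ->
  (#|units U| + 2 * #|units (perp e U)| = 3 * 4 ^ k)%N.
Proof.
move=> gU eU; set P := perp e U; have gP := nondeg_perp gU eU.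
have /unitsP[eU' ee] := eU.
have uP : units P \subset P by apply/subsetP => u /unitsP[].
(* As a e + v has norm a^3 + h v v, it is a unit vector iff a = 0 and v is a unit vector, or a != 0
   and v is isotropic (possibly 0). With n units in P this gives n + 3 (4^k - n). *)
pose A := setX [set 0] (units P) :|: setX [set~ (0 : F)] (P :\: units P).
have AP : A \subset setX setT P.
  apply/subsetP=> -[a v]; rewrite !inE /=; case: (_ == _); case: (v \in U);
  by case: (h v e == 0).
have -> : units U = [set p.1 *: e + p.2 | p in A].
  have key a v : v \in P -> (h (a *: e + v) (a *: e + v) == 1) = ((a, v) \in A).
    move=> vP; have /perpP[vU ve] := vP.
    rewrite !inE /= -!/(perp _ _) vU ve eqxx /= hDD hZZ ee mulr1 hZl (hC e v) ve.
    rewrite expr0n mulr0 expr0n !addr0.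
    have [->|a0] := eqVneq a 0; first by rewrite expr0n add0r /= orbF.
    rewrite (expr3_F4 F4 a0) /= andbT.
    by case: (h_diag v) => ->; rewrite ?addFF ?addr0 ?eqxx ?oner_eq0 // eq_sym oner_eq0.
  apply/setP=> u; apply/unitsP/imsetP => [[uU uu]|[[a v] avA ->]].
    move: uU uu; rewrite (split_image gU eU) => /imsetP[[a v] /setXP[_ vP] ->] /eqP.
    by rewrite key // => ?; exists (a, v).
  have /setXP[_ vP] := subsetP AP _ avA; split.
    by apply: (subsp_lin gU) => //; case/perpP: vP.
  by apply/eqP; rewrite key.
rewrite card_in_imset; last first.
  by move=> p q pA qA; apply: (split_inj eU); apply: (subsetP AP).
rewrite cardsU (_ : _ :&: _ = set0); last first.
  by apply/setP=> -[a v]; rewrite !inE /=; case: (_ == _); rewrite // ?andbF.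
rewrite cards0 subn0 !cardsX cards1 cardsC1 F4 (cardsD P) (setIidPr uP) (subsp_card gP).
have := subset_leq_card uP; rewrite (subsp_card gP).
by move: #|units P| (4 ^ k)%N => c n; lia.
Qed.

Lemma card_units k U : subspace_nondeg k U -> #|units U| = num_units k.
Proof.
elim: k U => [|k IH] U gU.
  have /eqP/cards1P[u Uu] := subsp_card gU; have := subsp_0 gU.
  rewrite Uu => /set1P u0; apply/eqP; rewrite cards_eq0; apply/eqP/setP=> v.
  rewrite [RHS]inE; apply/negP => /unitsP[/set1P-> /eqP].
  by rewrite -u0 h0l eq_sym oner_eq0.
have [e eU] := unit_exists gU; have := card_units_rec gU eU.
by rewrite (IH _ (nondeg_perp gU eU)) /=; lia.
Qed.

(** Once e is chosen in D, all other members lie in e^perp, one dimension lower. *)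
Lemma card_orthogonal k U D : subspace_nondeg k U -> D \subset units U ->
  (forall x y, x \in D -> y \in D -> x != y -> h x y = 0) -> (#|D| <= k)%N.
Proof.
elim: k U D => [|k IH] U D gU sD oD.
  by have := subset_leq_card sD; rewrite (card_units gU).
have [->|[e eD]] := set_0Vmem D; first by rewrite cards0.
rewrite (cardsD1 e) eD ltnS; apply: (IH (perp e U)).
- by apply: nondeg_perp => //; apply: (subsetP sD).
- apply/subsetP=> x /setD1P[xe xD]; have /unitsP[xU xx] := subsetP sD _ xD.
  by apply/unitsP; split=> //; apply/perpP; split=> //; apply: oD.
- by move=> x y /setD1P[_ xD] /setD1P[_ yD]; apply: oD.
Qed.

(** * Upper bound for sets without orthogonal pairs, and its equality case *)

Lemma nonorth_perp y U D : D \subset units U -> nonorth D ->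
  perp y D \subset units (perp y U) /\ nonorth (perp y D).
Proof.
move=> sD nD; split; last by move=> x z /perpP[xD _] /perpP[zD _]; apply: nD.
apply/subsetP=> x /perpP[xD xy]; have /unitsP[xU xx] := subsetP sD _ xD.
by apply/unitsP; split=> //; apply/perpP.
Qed.

(** Count orthogonal pairs (y, d) with d in D: the unit vectors of d^perp number [num_units k], and
    none of them lies in D. *)
Lemma sum_perp k U D : subspace_nondeg k.+1 U -> D \subset units U -> nonorth D ->
  (\sum_(y in units U :\: D) #|perp y D| = #|D| * num_units k)%N.
Proof.
move=> gU sD nD.
under eq_bigr do rewrite card_set_sum.
rewrite exchange_big /= -sum_nat_const; apply: eq_bigr => d dD.
rewrite -(card_units (nondeg_perp gU (subsetP sD _ dD))) -card_set_sum.
apply: eq_card => y; rewrite !inE h_eq0C.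
case: (boolP (y \in D)) => [yD|_] /=; last by rewrite andbAC.
by rewrite (negPf (nD _ _ yD dD)) !andbF.
Qed.


Lemma card_nonorth k U D : subspace_nondeg k U -> D \subset units U ->
  nonorth D -> (k * #|D| <= num_units k)%N.
Proof.
elim: k U D => [|k IH] U D gU sD nD; first by rewrite mul0n.
have le1 : (k * (#|D| * num_units k) <=
            (num_units k.+1 - #|D|) * num_units k)%N.
  rewrite -(sum_perp gU sD nD) -(card_units gU) -cardsDS // big_distrr /=.
  rewrite -sum_nat_const leq_sum // => y /setDP[yU _].
  have [sy ny] := nonorth_perp y sD nD.
  exact: IH (nondeg_perp gU yU) sy ny.
have := subset_leq_card sD; rewrite (card_units gU) => le2.
(* For k = 0 the double count is void, as [num_units 0] is 0; there the bound is just the inclusion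
   of D in [units U]. *)
case: (posnP k) le2 => [-> le2|k_gt0 le2]; first by rewrite mul1n.
have [e eU] := unit_exists gU; have gP := nondeg_perp gU eU.
have: (0 < num_units k)%N.
  rewrite -(card_units gP); case: k {IH le1 le2 gU} k_gt0 gP => // k _ gP.
  by apply/card_gt0P; apply: unit_exists gP.
by move: le1 le2; rewrite mulnA; move: #|D| (num_units k) => d n; nia.
Qed.

(** Equality in the double count behind [card_nonorth] forces equality in each of its terms. *)
Lemma card_nonorth_eq k U D y : subspace_nondeg k.+2 U -> D \subset units U ->
  nonorth D -> (k.+2 * #|D| = num_units k.+2)%N -> y \in units U -> y \notin D ->
  (k.+1 * #|perp y D| = num_units k.+1)%N.
Proof.
move=> gU sD nD eqD yU yD.
have le z : z \in units U :\: D ->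
    (k.+1 * #|perp z D| <= num_units k.+1 ?= iff
      (k.+1 * #|perp z D| == num_units k.+1))%N.
  move=> /setDP[zU _]; have [sz nz] := nonorth_perp z sD nD.
  by split=> //; apply: card_nonorth (nondeg_perp gU zU) sz nz.
have [_] := leqif_sum le.
rewrite -big_distrr /= (sum_perp gU sD nD) sum_nat_const cardsDS //.
rewrite (card_units gU) -eqD mulnA mulSn addKn eqxx => /esym/forall_inP.
by move=> /(_ y); rewrite inE yU yD => /(_ isT)/eqP.
Qed.

Lemma vline_scale a u : a != 0 -> <[a *: u]>%VS = <[u]>%VS.
Proof.
move=> a0; apply/eqP; rewrite eqEsubv -!memvE memvZ ?memv_line //=.
by apply/vlineP; exists a^-1; rewrite scalerA mulVf // scale1r.
Qed.

(** If a x were outside D, its hyperplane would meet D by [card_nonorth_eq]; but this is the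
    hyperplane of x, and no member of D is orthogonal to x. *)
Lemma nonorth_scale k U D a x : subspace_nondeg k.+2 U -> D \subset units U ->
  nonorth D -> (k.+2 * #|D| = num_units k.+2)%N -> a != 0 -> x \in D ->
  a *: x \in D.
Proof.
move=> gU sD nD eqD a0 xD; apply/negPn/negP=> axD.
have /unitsP[xU xx] := subsetP sD _ xD.
have axU : a *: x \in units U.
  by apply/unitsP; rewrite (subsp_Z gU) // hZZ expr3_F4 // mul1r.
have := card_nonorth_eq gU sD nD eqD axU axD.
have [e eU] := unit_exists gU; have gP := nondeg_perp gU eU.
have [f fP] := unit_exists gP.
have: (0 < num_units k.+1)%N.
  by rewrite -(card_units gP); apply/card_gt0P; exists f.
have -> : perp (a *: x) D = set0.
  apply/setP=> d; rewrite !inE; apply/negP=> /andP[dD].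
  rewrite hZr mulf_eq0 expf_eq0 (negPf a0) /=.
  by apply/negP; apply: nD.
by rewrite cards0 muln0 => lt0 eq0; rewrite -eq0 in lt0.
Qed.

(** Geometrically: the tangent at a point of a Hermitian curve in the plane meets the curve only in
    that point. *)
Lemma isotropic_perp3 U r s : subspace_nondeg 3 U -> r \in U -> s \in U ->
  r != 0 -> h r r = 0 -> h s s = 0 -> h s r = 0 -> exists a, s = a *: r.
Proof.
move=> gU rU sU r0 rr ss sr.
have [e eU re] := unit_not_perp gU rU r0; have /unitsP[eU' ee] := eU.
have gP := nondeg_perp gU eU.
(* The projection r' of r to e^perp is a unit vector, so the vectors orthogonal to both e and r'
   form a nondegenerate space of dimension 1. *)
have r'P := subsp_split gU eU rU.
set r' := r + _ in r'P.
have r'U : r' \in units (perp e U).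
  apply/unitsP; split=> //; rewrite /r' hDD hZZ ee rr (expr3_F4 F4 re) hZr.
  by rewrite -exprSr (expr3_F4 F4 re) expr1n addFF addr0 add0r mulr1.
have gQ := nondeg_perp gP r'U.
(* This a makes s - a r orthogonal to e; it is also isotropic and orthogonal to r, hence to r'. *)
pose a := h s e / h r e; exists a; apply/eqP; rewrite -subr_eq0; apply/eqP.
have -> : s - a *: r = a *: r + s.
  rewrite addrC; congr (_ + _); apply/eqP.
  by rewrite eq_sym -addr_eq0 vec_pchar2.
set z := _ + s.
have zP : z \in perp e U.
  apply/perpP; rewrite (subsp_lin gU) // hDl hZl divfK ?addFF //.
have zr : h z r = 0 by rewrite hDl hZl rr sr mulr0 addr0.
have zz : h z z = 0 by rewrite hDD hZZ rr ss hZl hC sr expr0n !mulr0 expr0n !addr0.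
have zQ : z \in perp r' (perp e U).
  apply/perpP; split=> //; rewrite hDr hZr zr.
  by have /perpP[_ ->] := zP; rewrite mulr0 addr0.
have sub : units (perp r' (perp e U)) \subset perp r' (perp e U) :\ 0.
  apply/subsetP=> x /unitsP[xQ xx]; rewrite in_setD1 xQ andbT.
  by apply/eqP=> x0; move: xx; rewrite x0 h0l => /eqP; rewrite eq_sym oner_eq0.
(* In dimension 1 the 3 unit vectors are all the nonzero vectors, so only 0 is isotropic. *)
have EQ : units (perp r' (perp e U)) = perp r' (perp e U) :\ 0.
  apply/eqP; rewrite eqEcard sub (card_units gQ) /=.
  by have := subsp_card gQ; rewrite (cardsD1 0) (subsp_0 gQ) add1n => /eqP; rewrite eqSS => /eqP->.
apply/eqP/negPn/negP => z0.
have : z \in units (perp r' (perp e U)) by rewrite EQ in_setD1 z0.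
by case/unitsP => _ /eqP; rewrite zz eq_sym oner_eq0.
Qed.

(** * Dimension 4: excluding the equality case of 30 vectors *)

Section Ovoid.
Variables (U D : {set V}).
Hypothesis gU : subspace_nondeg 4 U.
Hypothesis sD : D \subset units U.
Hypothesis nD : nonorth D.
Hypothesis cD : #|D| = 30%N.

Let DP x : x \in D -> x \in U /\ h x x = 1.
Proof. by move/(subsetP sD)/unitsP. Qed.

Let DZ a x : a != 0 -> x \in D -> a *: x \in D.
Proof. by apply: (nonorth_scale gU sD nD); rewrite cD. Qed.

Let card_perpD y : y \in units U -> y \notin D -> #|perp y D| = 12%N.
Proof.
move=> yU yD; have: (4 * #|D| = num_units 4)%N by rewrite cD.
by move/(card_nonorth_eq gU sD nD)=> /(_ y yU yD) /= ; move: #|perp y D| => n; lia.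
Qed.

(** Scale d to d' with h d' w = 1. Then d' + w is isotropic and orthogonal to w and r, so
    [isotropic_perp3] in the 3-space w^perp makes it a multiple of r. *)
Lemma tangent_perp w r d : w \in units U -> r \in U -> r != 0 -> h r r = 0 ->
  h w r = 0 -> d \in D -> h d r = 0 -> h d w != 0 ->
  exists t, w + t *: r = (h d w)^-1 *: d.
Proof.
move=> wU rU r0 rr wr dD dr dw; have /unitsP[wU' ww] := wU.
have [dU dd] := DP dD.
set d' := _ *: d.
have d'U : d' \in U by rewrite /d' (subsp_Z gU).
have d'w : h d' w = 1 by rewrite /d' hZl mulVf.
have d'd' : h d' d' = 1 by rewrite /d' hZZ dd expr3_F4 ?invr_eq0 // mulr1.
have gW := nondeg_perp gU wU.
have [||||||t st] := isotropic_perp3 (r := r) (s := d' + w) gW.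
- by apply/perpP; split=> //; apply/eqP; rewrite h_eq0C wr.
- by apply/perpP; rewrite (subsp_D gU) // hDl d'w ww addFF.
- by [].
- by [].
- by rewrite hDD d'd' ww d'w expr1n !addFF.
- by rewrite hDl wr /d' hZl dr mulr0 addr0.
by exists t; rewrite -st addrCA vec_pchar2 addr0.
Qed.

(* Count the pairs (t, d) with d in D orthogonal to w + t r.  Each w + t r
   outside D is orthogonal to 12 vectors of D.  A d in D is orthogonal to exactly
   one w + t r if h d r != 0; otherwise it is orthogonal to none, and is a
   multiple of some w + t r in D. *)
Lemma card_tangent w r t0 : w \in units U -> r \in U -> r != 0 -> h r r = 0 ->
  h w r = 0 -> w + t0 *: r \in D -> #|[set t | w + t *: r \in D]| = 2%N.
Proof.
move=> wU rU r0 rr wr t0D; have /unitsP[wU' ww] := wU.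
set S := [set t | _].
have lineU t : w + t *: r \in units U.
  apply/unitsP; rewrite addrC (subsp_lin gU) // addrC hDD ww hZZ rr hZr wr.
  by rewrite !mulr0 expr0n !addr0.
have line_r t : h (w + t *: r) r = 0 by rewrite hDl wr hZl rr mulr0 addr0.
pose B := [set d in D | h d r == 0].
have cB : #|B| = (3 * #|S|)%N.
  have -> : B = [set p.1 *: (w + p.2 *: r) | p in setX [set~ (0 : F)] S].
    apply/setP=> d; apply/idP/imsetP => [|[[a t] /setXP[/= a0 tS] ->]]; last first.
      move: a0 tS; rewrite !inE => a0 tS; rewrite DZ //=.
      by rewrite hZl line_r mulr0.
    rewrite inE => /andP[dD /eqP dr].
    have dw : h d w != 0.
      have := nD dD t0D; rewrite hDr hZr dr mulr0 addr0 //.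
    have [t td] := tangent_perp wU rU r0 rr wr dD dr dw.
    exists (h d w, t); last by rewrite /= td scalerA divff // scale1r.
    by rewrite in_setX !inE dw /= td DZ // invr_eq0.
  rewrite card_in_imset ?cardsX ?cardsC1 ?F4 //.
  move=> [a t] [b s] /setXP[/= + _] _ /= E; rewrite !inE => a0.
  have ab : a = b.
    have := congr1 (h^~ w) E; rewrite !hZl !hDl !hZl ww (hC r w) wr expr0n.
    by rewrite !mulr0 !addr0 !mulr1.
  move: E; rewrite -ab => /(scalerI a0)/addrI/eqP.
  by rewrite -subr_eq0 -scalerBl scaler_eq0 (negPf r0) orbF subr_eq0 => /eqP->.
have count : (\sum_(t : F) #|perp (w + t *: r) D| = #|D :\: B|)%N.
  under eq_bigr do rewrite card_set_sum.
  rewrite exchange_big /= -sum1_card [in RHS]big_mkcond /= [in LHS]big_mkcond /=.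
  apply: eq_bigr => d _; rewrite !inE; have [dD|//] := boolP (d \in D).
  rewrite andbT /= ; have [dr|dr] := eqVneq (h d r) 0.
    apply: big1 => t _; rewrite hDr hZr dr mulr0 addr0.
    have := nD dD t0D; rewrite hDr hZr dr mulr0 addr0.
    by move/negPf->.
  (* The equation h d w + t^2 h d r = 0 is solved by squaring, which is its own inverse since a^4 =
     a. *)
  rewrite (bigD1 ((h d w / h d r) ^+ 2)) //= hDr hZr -exprM expr4_F4 //.
  rewrite divfK // addFF eqxx big1 ?addn0 // => t tn; apply/eqP.
  rewrite eqb0; apply: contraNneq tn.
  rewrite hDr hZr => /eqP; rewrite addr_eq0 (oppr_pchar2 (pchar2_F4 F4)) => /eqP->.
  by rewrite mulfK // -exprM expr4_F4.
have count2 : (\sum_(t : F) #|perp (w + t *: r) D| = 12 * (4 - #|S|))%N.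
  have -> : (4 - #|S|)%N = #|~: S| by rewrite -[4%N]F4 -(cardsC S) addKn.
  rewrite mulnC -sum_nat_const.
  rewrite [RHS]big_mkcond; apply: eq_bigr => t _; rewrite inE.
  case: ifPn; rewrite !inE => tS; first exact: card_perpD.
  apply/eqP; rewrite cards_eq0; apply/eqP/setP=> d; rewrite !inE.
  by apply/negP=> /andP[dD]; apply/negP/nD => //; apply/negPn.
have BD : B \subset D by apply/subsetP=> d; rewrite inE => /andP[].
have B30 := subset_leq_card BD.
have S4 : (#|S| <= 4)%N by rewrite -F4 max_card.
have t0S : (0 < #|S|)%N by apply/card_gt0P; exists t0; rewrite inE.
(* With n = #|S| the two counts give 12 (4 - n) = 30 - 3 n, hence n = 2. *)
move: count; rewrite count2 cardsDS // cB cD; move: B30; rewrite cB cD.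
by move: S4; move: #|S| => n; lia.
Qed.

Lemma ovoid_false : False.
Proof.
have [u uU uD] : exists2 u, u \in units U & u \notin D.
  apply/subsetPn/negP => /subset_leq_card.
  by rewrite (card_units gU) cD.
have /unitsP[uU' uu] := uU.
have gW := nondeg_perp gU uU.
have [sD' nD'] := nonorth_perp u sD nD.
have cD' := card_perpD uU uD.
have [w wW wD'] : exists2 w, w \in units (perp u U) & w \notin perp u D.
  apply/subsetPn/negP => /subset_leq_card.
  by rewrite (card_units gW) cD'.
have /unitsP[/perpP[wU wu] ww] := wW.
have wD : w \notin D by apply: contra wD' => ?; apply/perpP.
have wU' : w \in units U by apply/unitsP.
have cw : #|perp w (perp u D)| = 3%N.
  have : (3 * #|perp u D| = num_units 3)%N by rewrite cD'.
  move/(card_nonorth_eq gW sD' nD') => /(_ w wW wD') /=.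
  by move: #|_| => n; lia.
(* Of the 12 vectors of D in u^perp, 3 are orthogonal to w. The other 9 are closed under nonzero
   scalars, and E takes one from each triple of multiples. *)
pose E := [set d in perp u D | h d w == 1].
have EP d : d \in E -> [/\ d \in D, h d u = 0 & h d w = 1].
  by rewrite inE => /andP[/perpP[dD du] /eqP dw].
have cE : #|E| = 3%N.
  have : #|perp u D :\: perp w (perp u D)| = 9%N.
    rewrite cardsDS ?cD' ?cw //.
    by apply/subsetP=> d /perpP[].
  have -> : perp u D :\: perp w (perp u D)
            = [set p.1 *: p.2 | p in setX [set~ (0 : F)] E].
    apply/setP=> d; apply/setDP/imsetP => [[dD' dn]|[[a e] /setXP[/= a0 eE] ->]].
      have /perpP[dD du] := dD'.
      have dw : h d w != 0 by apply: contra dn => /eqP dw; apply/perpP.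
      exists (h d w, (h d w)^-1 *: d); last by rewrite /= scalerA divff // scale1r.
      rewrite in_setX !inE dw /= DZ ?invr_eq0 //= !hZl du mulr0 eqxx /=.
      by rewrite mulVf.
    have [eD eu ew] := EP _ eE; move: a0; rewrite !inE => a0; rewrite DZ //.
    by rewrite !hZl eu ew mulr0 mulr1 eqxx a0.
  rewrite card_in_imset ?cardsX ?cardsC1 ?F4; first by move: #|E| => n; lia.
  move=> [a d] [b e] /setXP[/= + /EP[_ _ dw]] /setXP[_ /EP[_ _ /= ew]] /= eq.
  rewrite !inE => a0; have := congr1 (h^~ w) eq; rewrite !hZl dw ew !mulr1 => ab.
  by move: eq; rewrite -ab => /(scalerI a0) ->.
(* For d in E, d + w is isotropic and orthogonal to w, so [f d] is the isotropic point of the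
   tangent line through w and d. The fibres of f group E by these lines. *)
pose f (d : V) := <[d + w]>%VS.
have part := preim_partitionP f E.
have : {in preim_partition f E, forall A : {set V}, #|A| = 2%N}.
  move=> A /imsetP[d dE ->]; have [dD du dw] := EP _ dE.
  have [dU dd] := DP dD.
  have r0 : d + w != 0.
    by apply: contraNneq wD => /eqP; rewrite addr_eq0 -addr_eq0 => /eqP dw0;
       rewrite -(addKr d w) dw0 addr0 -scaleN1r DZ // oppr_eq0 oner_eq0.
  have rr : h (d + w) (d + w) = 0 by rewrite hDD dd ww dw expr1n !addFF.
  have wr : h w (d + w) = 0 by rewrite hDr ww hC dw expr1n addFF.
  have wd : w + 1 *: (d + w) = d by rewrite scale1r addrCA vec_pchar2 addr0.
  have rU : d + w \in U by rewrite (subsp_D gU).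
  (* Here [t0 = 1] because w + (d + w) = d. Every w + t (d + w) has product 1 with w and 0 with u,
     so those in D lie in E and form the class of d. *)
  rewrite -(card_tangent (r := d + w) (t0 := 1) wU') // ?wd //.
  rewrite -(card_imset _ (f := fun t => w + t *: (d + w))); last first.
    move=> s t /addrI/eqP; rewrite -subr_eq0 -scalerBl scaler_eq0 (negPf r0) orbF.
    by rewrite subr_eq0 => /eqP.
  apply: eq_card => e; rewrite inE; apply/andP/imsetP => [[eE /eqP fde]|[t + ->]].
    have : e + w \in <[d + w]>%VS by rewrite -/(f d) fde memv_line.
    case/vlineP => t et; exists t; last by rewrite -et addrCA vec_pchar2 addr0.
    by rewrite inE -et addrCA vec_pchar2 addr0; case/EP: eE.
  rewrite inE => tD; split.
    rewrite !inE tD !hDl !hZl !hDl ww wu du dw !(addFF, mulr0, addr0).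
    by rewrite !eqxx.
  rewrite /f [w + _]addrC -addrA vec_pchar2 addr0 /= vline_scale ?eqxx //.
  by apply: contraNneq wD => t0; move: tD; rewrite t0 scale0r addr0.
move=> /card_uniform_partition/(_ part); rewrite cE.
by move: #|_| => n; lia.
Qed.

End Ovoid.

(** * The strict bound in all dimensions above 3 *)

Lemma card_nonorth_lt k U D : (3 < k)%N -> subspace_nondeg k U ->
  D \subset units U -> nonorth D -> (k * #|D| < num_units k)%N.
Proof.
elim: k U D => [//|k IH] U D; rewrite ltnS leq_eqVlt => /orP[/eqP <-|k3] gU sD nD.
  (* The weak bound 4 |D| <= 120 is an equality only for |D| = 30. *)
  have := card_nonorth gU sD nD; have := @ovoid_false U D gU sD nD.
  by rewrite /=; move: #|D| => n; lia.
have N_gt0 : (0 < num_units k)%N.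
  have [e eU] := unit_exists gU; have gP := nondeg_perp gU eU.
  by have := IH _ set0 k3 gP (sub0set _); rewrite cards0 muln0;
     apply=> x y; rewrite inE.
have := subset_leq_card sD; rewrite (card_units gU).
(* By induction each term of the double count is now at most [num_units k] - 1. *)
have : (k * (#|D| * num_units k) <=
        (num_units k.+1 - #|D|) * (num_units k).-1)%N.
  rewrite -(sum_perp gU sD nD) -(card_units gU) -cardsDS // big_distrr /=.
  rewrite -sum_nat_const leq_sum // => y /setDP[yU _].
  have [sy ny] := nonorth_perp y sD nD.
  have := IH _ _ k3 (nondeg_perp gU yU) sy ny.
  by move: #|perp y D| => n; lia.
(* This settles the case D = [units U], where the double count is an empty sum and gains nothing
   from strictness. *)
have : (0 < num_units k.+1)%N.
  by rewrite -(card_units gU); apply/card_gt0P; apply: unit_exists gU.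
rewrite mulnA; move: (num_units k.+1) #|D| => n d; nia.
Qed.

End HermitianSpace.

(** * From the graph to unit vectors: adjacency, cliques and cocliques *)

Section UnitaryGraph.
Variables (m : nat) (F : finFieldType) (F4 : #|F| = 4%N).
Variables (theta : {rmorphism F -> F}) (theta_sq : forall a : F, theta a = a ^+ 2).
Variable h : {hermitian_sym 'rV[F]_m for theta}.
Implicit Types (x y u : 'rV[F]_m) (P Q : NU h).

Let hDl u v w : h (u + v) w = h u w + h v w.
Proof. exact: linearDl. Qed.

Let hZl a u v : h (a *: u) v = a * h u v.
Proof. exact: linearZl_LR. Qed.

Let hC u v : h u v = h v u ^+ 2.
Proof. by rewrite hermC expr0 mul1r theta_sq. Qed.

Let addFF (a : F) : a + a = 0 := addrr_pchar2 (pchar2_F4 F4) a.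

Lemma nondegenerate_setT : nondegenerate h -> subspace_nondeg h m [set: 'rV[F]_m].
Proof.
move=> /eqP nd; split=> [a u v _ _|| u _ hu]; first by rewrite inE.
  by rewrite cardsT card_mx F4 mul1n.
apply/eqP; rewrite -memv0 -nd.
by apply/mem_orthovP => v _; apply: hu; rewrite inE.
Qed.

(** Rescale x so that h x y is 0 or 1. If it is 0, every x + b y with b != 0 is isotropic, giving
    several points. If it is 1, a x + b y has norm (a + b)^3, so x + y spans the only isotropic
    point. *)
Lemma tangent_units x y : h x x = 1 -> h y y = 1 -> <[x]>%VS != <[y]>%VS ->
  tangent h (<[x]> + <[y]>) = (h x y != 0).
Proof.
wlog hxy : x / h x y = 0 \/ h x y = 1 => [th xx yy xy|xx yy xy].
  have [xy0|xy0] := eqVneq (h x y) 0.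
    by rewrite th // ?xy0 ?eqxx //; left.
  have xy0' : (h x y)^-1 != 0 by rewrite invr_eq0.
  have := th ((h x y)^-1 *: x).
  rewrite vline_scale // hZZ // xx expr3_F4 // mul1r hZl mulVf // oner_eq0.
  by apply=> //; right.
have yx : h y x = h x y by rewrite hC; case: hxy => ->; rewrite ?expr0n ?expr1n.
have qE a b : h (a *: x + b *: y) (a *: x + b *: y)
    = a ^+ 3 + b ^+ 3 + (a * b ^+ 2 + a ^+ 2 * b) * h x y.
  have xy2 : h x y ^+ 2 = h x y by rewrite -hC.
  rewrite hDD // !hZZ // xx yy hZl hZr // exprMn [(_ * h x y) ^+ 2]exprMn.
  rewrite -exprM (expr4_F4 F4) xy2.
  ring.
have memL a b : a *: x + b *: y \in (<[x]> + <[y]>)%VS.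
  by rewrite memv_add // memvZ ?memv_line.
rewrite /tangent; case: hxy => xyE.
  rewrite xyE eqxx; apply/negP=> /cards1P[P0 /setP E].
  (* This t is a scalar other than 0 and 1, so x + t y and x + y span distinct isotropic points. *)
  have [t t1] := trace1_F4 F4.
  have t0 : t != 0 by apply: contra_eq_neq t1 => ->; rewrite expr0n addr0 eq_sym oner_eq0.
  have pt b : b != 0 -> <[1 *: x + b *: y]>%VS = P0.
    move=> b0; apply/set1P; rewrite -E inE -memvE memL andbT.
    apply/existsP; exists (1 *: x + b *: y); rewrite eqxx qE xyE !expr3_F4 ?oner_eq0 //.
    rewrite addFF mulr0 addr0 eqxx !andbT; apply: contraTneq (oner_neq0 F) => z.
    have := congr1 (h x) z.
    rewrite hDr // !hZr // xx xyE mulr0 addr0 expr1n mulr1 (hC x 0) h0l // expr0n.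
    by move=> ->; rewrite eqxx.
  have := memv_line (1 *: x + t *: y).
  rewrite pt // -(pt 1) ?oner_eq0 // => /vlineP[s es].
  have := congr1 (h^~ x) es; have := congr1 (h^~ y) es.
  rewrite !hZl !hDl !hZl xx yy yx xyE !mulr0 !mulr1 !add0r !addr0 !mulr1 => ts s1.
  by move: t1; rewrite ts -s1 expr1n addFF => /eqP; rewrite eq_sym oner_eq0.
rewrite xyE oner_eq0 /=; apply/eqP.
suff -> : [set P | isotropic h P && (P <= <[x]> + <[y]>)%VS] = [set <[x + y]>%VS].
  exact: cards1.
apply/setP=> P; rewrite !inE; apply/andP/eqP => [[/existsP[z /and3P[z0 /eqP -> zz]]]|->].
  rewrite -memvE => /memv_addP[_ /vlineP[a ->] [_ /vlineP[b ->] zE]].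
  have : (a + b) ^+ 3 = 0.
    move/eqP: zz; rewrite zE qE xyE mulr1 => <-.
    rewrite exprS sqrrD_F4 //; ring.
  move/eqP; rewrite expf_eq0 addr_eq0 (oppr_pchar2 (pchar2_F4 F4)) => /eqP ab.
  rewrite zE ab -scalerDr vline_scale //.
  by apply: contraNneq z0 => b0; rewrite zE ab b0 !scale0r addr0.
have -> : x + y = 1 *: x + 1 *: y by rewrite !scale1r.
rewrite -memvE memL; split=> //.
apply/existsP; exists (1 *: x + 1 *: y); rewrite eqxx qE xyE !expr1n !mulr1 !addFF eqxx.
rewrite !scale1r !andbT addr_eq0; apply: contraNneq xy => ->.
by rewrite -scaleN1r vline_scale // oppr_eq0 oner_eq0.
Qed.

Definition gen P : 'rV[F]_m := vpick (val P).

(** Norms are 0 or 1 and are unchanged by nonzero scalars, so every generator of a nonisotropic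
    point has norm 1. *)
Lemma gen_spec P : val P = <[gen P]>%VS /\ h (gen P) (gen P) = 1.
Proof.
have /existsP[x /and3P[x0 /eqP Px hx]] := valP P.
have /vlineP[a ga] : gen P \in <[x]>%VS by rewrite -Px memv_pick.
have a0 : a != 0.
  apply: contraNneq x0 => a0; have /eqP := ga.
  by rewrite a0 scale0r vpick0 Px -memv0 => /eqP <-; apply: memv_line.
rewrite ga vline_scale // hZZ // expr3_F4 // mul1r; split=> //.
by have [/eqP|//] := h_diag hC x; rewrite (negPf hx).
Qed.

Lemma adjE P Q : P != Q -> adj P Q = (h (gen P) (gen Q) != 0).
Proof.
move=> PQ; rewrite /adj /= /NU_adj PQ /=.
have [PE Pu] := gen_spec P; have [QE Qu] := gen_spec Q.
rewrite {1}PE {1}QE tangent_units // -PE -QE.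
by apply: contra PQ => /eqP/val_inj->.
Qed.

Lemma gen_inj a b P Q : a != 0 -> b != 0 -> a *: gen P = b *: gen Q ->
  P = Q /\ a = b.
Proof.
move=> a0 b0 E; have PQ : P = Q.
  apply: val_inj; rewrite (gen_spec P).1 (gen_spec Q).1.
  by rewrite -(vline_scale _ a0) E vline_scale.
split=> //; have := congr1 (h^~ (gen P)) E.
by rewrite -PQ !hZl (gen_spec P).2 !mulr1.
Qed.

(** The set D attached to A: all unit vectors on the points of A, three on each. *)
Definition cover_units (A : {set NU h}) : {set 'rV[F]_m} :=
  [set p.1 *: gen p.2 | p in setX [set~ (0 : F)] A].

Lemma cover_unitsP (A : {set NU h}) u : reflect (exists a P, [/\ a != 0, P \in A & u = a *: gen P])
  (u \in cover_units A).
Proof.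
apply: (iffP imsetP) => [[[a P] /setXP[/= + PA] ->]|[a [P [a0 PA ->]]]].
  by rewrite !inE => a0; exists a, P.
by exists (a, P); rewrite // !inE a0.
Qed.

Lemma card_cover_units (A : {set NU h}) : #|cover_units A| = (3 * #|A|)%N.
Proof.
rewrite card_in_imset ?cardsX ?cardsC1 ?F4 //.
move=> [a P] [b Q] /setXP[/= + _] /setXP[/= + _]; rewrite !inE => a0 b0 E.
by have [-> ->] := gen_inj a0 b0 E.
Qed.

Lemma cover_units_sub (A : {set NU h}) : cover_units A \subset units h setT.
Proof.
apply/subsetP=> _ /cover_unitsP[a [P [a0 _ ->]]]; apply/unitsP; rewrite inE.
by rewrite hZZ // (gen_spec P).2 expr3_F4 // mulr1.
Qed.

(** With [card_cover_units] this bounds the number of unit vectors by three times the number of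
    vertices. *)
Lemma cover_units_all : units h setT \subset cover_units setT.
Proof.
apply/subsetP=> u /unitsP[_ uu].
have u0 : u != 0.
  by apply: contra_eq_neq uu => ->; rewrite h0l // eq_sym oner_eq0.
have uP : nonisotropic h <[u]>%VS.
  by apply/existsP; exists u; rewrite u0 eqxx uu oner_eq0.
pose P : NU h := Sub <[u]>%VS uP.
have : u \in <[gen P]>%VS by rewrite -(gen_spec P).1 SubK memv_line.
case/vlineP=> a ua; apply/cover_unitsP; exists a, P; rewrite inE; split=> //.
by apply: contraNneq u0 => a0; rewrite ua a0 scale0r.
Qed.

Lemma nonorth_clique (A : {set NU h}) : clique A -> nonorth h (cover_units A).
Proof.
move=> /forall_inP cA _ _ /cover_unitsP[a [P [a0 PA ->]]] /cover_unitsP[b [Q [b0 QA ->]]].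
rewrite hZl hZr // mulf_neq0 // mulf_neq0 ?expf_neq0 //.
have [->|PQ] := eqVneq P Q; first by rewrite (gen_spec Q).2 oner_eq0.
by rewrite -adjE //; move/forall_inP: (cA P PA) => /(_ Q QA); rewrite PQ.
Qed.

Lemma card_coclique (A : {set NU h}) : nondegenerate h -> coclique A -> (#|A| <= m)%N.
Proof.
move=> nd /forall_inP cA; rewrite -(card_in_imset (f := gen)); last first.
  move=> P Q _ _ E; have [|||//] := @gen_inj 1 1 P Q; rewrite ?oner_eq0 //.
  by rewrite E.
apply: (card_orthogonal F4 hDl hZl hC (nondegenerate_setT nd)).
  by apply/subsetP=> _ /imsetP[P _ ->]; apply/unitsP; rewrite inE (gen_spec P).2.
move=> _ _ /imsetP[P PA ->] /imsetP[Q QA ->] PQ; apply/eqP/negPn.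
have PQ' : P != Q by apply: contraNneq PQ => ->.
by rewrite -adjE //; move/forall_inP: (cA P PA) => /(_ Q QA); rewrite PQ'.
Qed.

End UnitaryGraph.

(** * Comparison of the clique and coclique bounds with the number of vertices *)

Theorem theorem3p2 (m : nat) (hm : (3 < m)%N)
    (F : finFieldType) (F4 : #|F| = 4%N)
    (theta : {rmorphism F -> F}) (theta_sq : forall a : F, theta a = a ^+ 2)
    (h : {hermitian_sym 'rV[F]_m for theta}) (h_nondeg : nondegenerate h) :
  separating (NU h).
Proof.
have hDl u v w : h (u + v) w = h u w + h v w by exact: linearDl.
have hZl a u v : h (a *: u) v = a * h u v by exact: linearZl_LR.
have hC u v : h u v = h v u ^+ 2 by rewrite hermC expr0 mul1r theta_sq.
have gV := nondegenerate_setT F4 h_nondeg.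
have alpha_le : (alpha (NU h) <= m)%N.
  by apply/bigmax_leqP => A; apply: (card_coclique F4 theta_sq).
(* The empty clique ensures that the maximum is attained by some clique A. *)
have clique0 : (0 < #|@clique (NU h)|)%N.
  by apply/card_gt0P; exists set0; apply/forall_inP=> x; rewrite inE.
have [A cA omegaA] := eq_bigmax_cond (fun A : {set NU h} => #|A|) clique0.
rewrite -[LHS]/(omega (NU h)) in omegaA.
have := card_nonorth_lt F4 hDl hZl hC hm gV (cover_units_sub F4 theta_sq A)
          (nonorth_clique F4 theta_sq cA).
have := subset_leq_card (cover_units_all F4 theta_sq h).
rewrite (card_units F4 hDl hZl hC gV) !card_cover_units // cardsT => le1 lt2.
rewrite /separating omegaA; apply: (@leq_ltn_trans (#|A| * m)%N).
  by rewrite leq_mul2l alpha_le orbT.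
(* Cancel 3 in m * (3 |A|) < [num_units m] <= 3 |V|, with V the vertex set. *)
have := leq_trans lt2 le1; rewrite mulnCA ltn_pmul2l // mulnC.
by [].
Qed.
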